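(* Let $n,m,p$ be positive integers, $B\in\mathbb{R}^{n\times m}$, $A\in\mathbb{R}^{n\times p}$, and $\mu>0$. Then the problem $$\begin{aligned}\min_{Y\in\mathrm{Conv}(\mathcal{Y}_m)}\ \min_{X\in\mathbb{R}^{p\times m},\,W\in\mathcal{S}^{pm}_+}\quad & \Big\langle A^\top A,\sum_{i\in[m]}W^{(i,i)}\Big\rangle+\langle B,B\rangle-2\langle AX,B\rangle+\mu\,\mathrm{tr}(Y) \\ \text{s.t.}\quad & W\succeq\mathrm{vec}(X)\mathrm{vec}(X)^\top,\qquad\begin{pmatrix}\sum_{i\in[m]}W^{(i,i)} & X \\ X^\top & Y\end{pmatrix}\succeq0\end{aligned}$$ attains the same objective value as $$\begin{aligned}\min_{Y\in\mathrm{Conv}(\mathcal{Y}_m)}\ \min_{X\in\mathbb{R}^{p\times m},\,\theta\in\mathcal{S}^p_+}\quad & \langle A^\top A,\theta\rangle+\langle B,B\rangle-2\langle AX,B\rangle+\mu\,\mathrm{tr}(Y) \\ \text{s.t.}\quad & \begin{pmatrix}\theta & X \\ X^\top & Y\end{pmatrix}\succeq0.\end{aligned}$$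
   Context: $\mathcal{S}^d_+$ is the set of $d\times d$ real symmetric positive semidefinite matrices; $\langle\cdot,\cdot\rangle$ is the trace inner product; $[m]=\{1,\dots,m\}$; $\mathrm{vec}$ stacks columns. $W\in\mathcal{S}^{pm}_+$ is partitioned into an $m\times m$ array of $p\times p$ blocks $W^{(i,j)}$. $\mathcal{Y}_m$ is the set of all $m\times m$ orthogonal projection matrices (of any rank), with convex hull $\mathrm{Conv}(\mathcal{Y}_m)=\{P\in\mathcal{S}^m_+:P\preceq I_m\}$. ''Objective value'' means optimal value (infimum). *)

(* Defs.v *)
From mathcomp Require Export all_boot all_order all_algebra.
From mathcomp Require Export all_classical all_reals all_analysis.

Set Implicit Arguments.
Unset Strict Implicit.
Unset Printing Implicit Defensive.

Import Order.TTheory GRing.Theory Num.Theory.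

Local Open Scope classical_set_scope.
Local Open Scope ring_scope.

Definition trdot (R : realType) (n m : nat) (A B : 'M[R]_(n, m)) : R :=
  \tr (A^T *m B).

Definition psd (R : realType) (n : nat) : set 'M[R]_n :=
  [set A | A^T = A /\ forall x : 'cV[R]_n, 0 <= (x^T *m A *m x) 0 0].

(* Loewner order *)
Definition lemx (R : realType) (n : nat) (A B : 'M[R]_n) : Prop :=
  psd (B - A).

Definition orthoproj (R : realType) (m : nat) : set 'M[R]_m :=
  [set P | P^T = P /\ P *m P = P].

Definition conv_hull (R : realType) (E : lmodType R) (A : set E) : set E :=
  smallest (@convex_set R E) A.

(* Vectors of length pm, and matrices of order pm made of an m x m array of
   p x p blocks, are indexed by 'I_(\sum_(i < m) p), so that the block W^(i,j)
   is [submxblock W i j]. *)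
Definition vec (R : realType) (p m : nat) (X : 'M[R]_(p, m)) :
    'cV[R]_(\sum_(i < m) p) :=
  \mxcol_(i < m) col i X.

Definition diagsum (R : realType) (p m : nat)
    (W : 'M[R]_(\sum_(i < m) p)) : 'M[R]_p :=
  \sum_(i < m) submxblock W i i.

(* The objective shared by the two problems, the first one having
   theta = diagsum W. *)
Definition objective (R : realType) (n m p : nat) (B : 'M[R]_(n, m))
    (A : 'M[R]_(n, p)) (mu : R) (Y : 'M[R]_m) (X : 'M[R]_(p, m))
    (theta : 'M[R]_p) : R :=
  trdot (A^T *m A) theta + trdot B B - trdot (A *m X) B *+ 2 + mu * \tr Y.

(* Optimal values are infima in the extended reals: +oo on an empty feasible
   set, -oo for an objective unbounded below. *)
Definition value_W (R : realType) (n m p : nat) (B : 'M[R]_(n, m))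
    (A : 'M[R]_(n, p)) (mu : R) : \bar R :=
  ereal_inf [set ereal_inf
    [set (objective B A mu Y XW.1 (diagsum XW.2))%:E
      | XW in [set XW : 'M[R]_(p, m) * 'M[R]_(\sum_(i < m) p) |
          [/\ psd XW.2,
              lemx (vec XW.1 *m (vec XW.1)^T) XW.2
            & psd (block_mx (diagsum XW.2) XW.1 XW.1^T Y)]]]
    | Y in conv_hull (@orthoproj R m)].

Definition value_theta (R : realType) (n m p : nat) (B : 'M[R]_(n, m))
    (A : 'M[R]_(n, p)) (mu : R) : \bar R :=
  ereal_inf [set ereal_inf
    [set (objective B A mu Y Xt.1 Xt.2)%:E
      | Xt in [set Xt : 'M[R]_(p, m) * 'M[R]_p |
          psd Xt.2 /\ psd (block_mx Xt.2 Xt.1 Xt.1^T Y)]]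
    | Y in conv_hull (@orthoproj R m)].

(* Main.v *)
Require Import Defs.
Import Order.TTheory GRing.Theory Num.Theory.

Set Implicit Arguments.
Unset Strict Implicit.
Unset Printing Implicit Defensive.

(** The objective sees [W] only through its diagonal sum, so it is enough that
    both problems have, for every feasible [Y], the same attainable pairs
    [(X, theta)].  A feasible [W] gives the pair [(X, diagsum W)]; the
    semidefiniteness of [theta] is that of a diagonal block
    ([psd_block_ulsubmx]).

    Conversely, let [(X, theta)] be feasible for the second problem.  Every [Y]
    in the convex hull of the projections satisfies [Y <= 1] in the Loewner
    order ([lemx_conv_orthoproj]), and then the block constraint forces
    [X X^T <= theta] ([lemx_block]).  Since [X X^T] is exactly the diagonal sum
    of [vec X (vec X)^T] ([diagsum_vec]), there is room to add to the latter
    the positive semidefinite slack [theta - X X^T], placed in a single diagonal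
    block.  The resulting [W] has diagonal sum [theta] ([exists_lift]). *)

Local Open Scope classical_set_scope.
Local Open Scope ring_scope.

Lemma psdD (R : realType) n (A B : 'M[R]_n) : psd A -> psd B -> psd (A + B).
Proof.
move=> [symA A_ge0] [symB B_ge0]; split; first by rewrite linearD /= symA symB.
by move=> x; rewrite mulmxDr mulmxDl mxE addr_ge0.
Qed.

Lemma psdZ (R : realType) n (a : R) (A : 'M[R]_n) :
  0 <= a -> psd A -> psd (a *: A).
Proof.
move=> a_ge0 [symA A_ge0]; split; first by rewrite linearZ /= symA.
by move=> x; rewrite -scalemxAr -scalemxAl mxE mulr_ge0.
Qed.

Lemma psd_congr (R : realType) n k (A : 'M[R]_n) (C : 'M[R]_(n, k)) :
  psd A -> psd (C^T *m A *m C).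
Proof.
move=> [symA A_ge0]; split; first by rewrite !trmx_mul trmxK symA mulmxA.
by move=> x; have := A_ge0 (C *m x); rewrite trmx_mul !mulmxA.
Qed.

Lemma psd1 (R : realType) n : psd (1%:M : 'M[R]_n).
Proof.
split=> [|x]; first exact: trmx1.
by rewrite mulmx1 mxE sumr_ge0 // => i _; rewrite mxE -expr2 sqr_ge0.
Qed.

Lemma psd_gram (R : realType) n k (C : 'M[R]_(n, k)) : psd (C^T *m C).
Proof. by have := psd_congr C (psd1 R n); rewrite mulmx1. Qed.

Lemma lemx_orthoproj (R : realType) m (P : 'M[R]_m) :
  orthoproj P -> lemx P 1%:M.
Proof.
move=> [symP idemP].
(* The complement of an orthogonal projection is one too, hence its own Gram
   matrix. *)
have := psd_gram (1%:M - P); congr psd.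
have -> : (1%:M - P)^T = 1%:M - P by rewrite raddfB /= trmx1 symP.
by rewrite mulmxBr mulmx1 mulmxBl mul1mx idemP subrr subr0.
Qed.

(** The matrices below the identity form a convex set containing the
    projections: [1 - (t Y + (1 - t) Z)] is the same combination of [1 - Y] and
    [1 - Z], and a convex combination of semidefinite matrices is semidefinite. *)
Lemma lemx_conv_orthoproj (R : realType) m (Y : 'M[R]_m) :
  conv_hull (@orthoproj R m) Y -> lemx Y 1%:M.
Proof.
move: Y; apply: smallest_sub => [|P]; last exact: lemx_orthoproj.
move=> Y Z t; rewrite !inE => leY leZ.
rewrite /= /lemx.
have -> : 1%:M - (conv t (Y : convex_lmodType _) (Z : convex_lmodType _)
            : 'M[R]_m) =
    t%:num *: (1%:M - Y) + (1 - t%:num) *: (1%:M - Z).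
  rewrite [conv _ _ _](_ : _ = t%:num *: Y + (1 - t%:num) *: Z) //.
  by rewrite !scalerBr addrACA -scalerDl -opprD addrC [t%:num + _]addrC subrK
    scale1r addrC.
by apply: psdD; apply: psdZ => //; rewrite subr_ge0.
Qed.

Lemma psd_block_ulsubmx (R : realType) p m (theta : 'M[R]_p)
    (X : 'M[R]_(p, m)) (Y : 'M[R]_m) :
  psd (block_mx theta X X^T Y) -> psd theta.
Proof.
move=> /(psd_congr (col_mx 1%:M 0)).
by rewrite tr_col_mx mul_row_block mul_row_col !trmx1 !trmx0 !mul1mx !mul0mx
  mulmx0 mulmx1 !addr0.
Qed.

(** Congruence of the block matrix by the column [(1, - X^T)] gives
    [0 <= theta - 2 X X^T + X Y X^T], and [Y <= 1] bounds [X Y X^T] by [X X^T].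
    The column is the minimizing choice for the Schur complement when [Y = 1]. *)
Lemma lemx_block (R : realType) p m (theta : 'M[R]_p)
    (X : 'M[R]_(p, m)) (Y : 'M[R]_m) :
  lemx Y 1%:M -> psd (block_mx theta X X^T Y) -> lemx (X *m X^T) theta.
Proof.
move=> leY /(psd_congr (col_mx 1%:M (- X^T))) psdC.
rewrite /lemx; have := psdD psdC (psd_congr X^T leY).
congr psd; rewrite tr_col_mx mul_row_block mul_row_col trmx1 linearN /= trmxK.
rewrite !mul1mx !mulmxDl !mulmxBr !mulNmx !mulmxN !mulmx1 mulmxDl mulNmx.
by rewrite opprK [- (X *m X^T) + _]addrC -[X *m X^T - X *m Y *m _]opprB addrK.
Qed.

Lemma diagsumD (R : realType) p m (W V : 'M[R]_(\sum_(i < m) p)) :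
  diagsum (W + V) = diagsum W + diagsum V.
Proof.
by rewrite /diagsum -big_split; apply: eq_bigr => i _; rewrite submxblockD.
Qed.

Lemma diagsum_vec (R : realType) p m (X : 'M[R]_(p, m)) :
  diagsum (vec X *m (vec X)^T) = X *m X^T.
Proof.
rewrite /diagsum /vec tr_mxcol mul_mxcol_mxrow.
under eq_bigr do rewrite mxblockK.
apply/matrixP => k l; rewrite summxE mxE; apply: eq_bigr => i _.
by rewrite mxE big_ord1 !mxE.
Qed.

(** The embedding of the [i0]-th summand in a sum of [m] copies of [R^p];
    congruence by its transpose puts a [p x p] matrix in the diagonal block
    [i0] and zeros elsewhere. *)
Definition blockinj (R : realType) p m (i0 : 'I_m) :
    'M[R]_(\sum_(i < m) p, p) :=
  \mxcol_(i < m) (if i == i0 then 1%:M else 0 : 'M[R]_p).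

Lemma diagsum_blockinj (R : realType) p m (i0 : 'I_m) (T : 'M[R]_p) :
  diagsum (blockinj R p i0 *m T *m (blockinj R p i0)^T) = T.
Proof.
rewrite /diagsum /blockinj tr_mxcol mxcol_mul mul_mxcol_mxrow.
under eq_bigr do rewrite mxblockK.
rewrite (bigD1 i0) //= eqxx mul1mx trmx1 mulmx1 big1 ?addr0 // => i /negPf ->.
by rewrite !mul0mx.
Qed.

(** The required inequality [vec X (vec X)^T <= W] holds because the slack is
    added to the left-hand side; where on the diagonal it goes is immaterial to
    the diagonal sum, so any block index [i0] serves. *)
Lemma exists_lift (R : realType) p m (i0 : 'I_m) (theta : 'M[R]_p)
    (X : 'M[R]_(p, m)) :
  lemx (X *m X^T) theta ->
  exists W, [/\ psd W, lemx (vec X *m (vec X)^T) W & diagsum W = theta].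
Proof.
move=> leX; set J := blockinj R p i0.
have psdE : psd (J *m (theta - X *m X^T) *m J^T).
  by have := psd_congr J^T leX; rewrite trmxK.
exists (vec X *m (vec X)^T + J *m (theta - X *m X^T) *m J^T); split.
- by apply: psdD psdE; have := psd_gram (vec X)^T; rewrite trmxK.
- by rewrite /lemx addrC addKr.
- by rewrite diagsumD diagsum_vec diagsum_blockinj addrC subrK.
Qed.

Theorem corollary2 (R : realType) (n m p : nat)
    (n_gt0 : (0 < n)%N) (m_gt0 : (0 < m)%N) (p_gt0 : (0 < p)%N)
    (B : 'M[R]_(n, m)) (A : 'M[R]_(n, p)) (mu : R) (mu_gt0 : 0 < mu) :
  value_W B A mu = value_theta B A mu.
Proof.
congr ereal_inf; apply: eq_imagel => Y hullY; congr ereal_inf.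
apply/seteqP; split=> [_ [[X W] /= [_ _ psdM] <-]|_ [[X theta] /= [_ psdM] <-]].
  by exists (X, diagsum W) => //=; split=> //; exact: psd_block_ulsubmx psdM.
have leX := lemx_block (lemx_conv_orthoproj hullY) psdM.
have [W [psdW leW sumW]] := exists_lift (Ordinal m_gt0) leX.
by exists (X, W); rewrite /= sumW.
Qed.
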